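(* There is a constant $c>0$ such that, for all integers $r\geq 2$, $d\geq 3r$, and $z\geq 2r$, if a graph has minimum degree $d$ and $\theta_{r}$-girth at least $z$, then it contains as a minor a clique of size $k$, for some integer $k$ with $$k\geq \frac{\left(\frac{d}{r}\right)^{c\, \frac{z}{r}}}{\sqrt{\frac{z}{r}\cdot \log d}}.$$
   Context: Graphs are finite, undirected, loopless, and may have multiple edges. The degree of a vertex $v$ in $G$ is $|N_G(v)|$, the number of vertices adjacent to $v$ (parallel edges are not counted with multiplicity); the minimum degree of $G$ is the minimum of these degrees. $H$ is a minor of $G$ if $H$ can be obtained from $G$ by vertex removals, edge removals and edge contractions (parallel edges arising from contractions are kept, loops are discarded). An $H$-model in $G$ is a subgraph of $G$ that contains $H$ as a minor. The $H$-girth of $G$ is the minimum number of edges of an $H$-model in $G$, and is $\infty$ if $G$ does not contain $H$ as a minor. $\theta_r$ is the graph with two vertices and $r$ parallel edges. Logarithms are binary. *)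

(* Defs.v *)
From HB Require Import structures.
From mathcomp Require Import all_boot all_order all_algebra.
From mathcomp Require Import all_classical all_reals all_analysis.

Set Implicit Arguments.
Unset Strict Implicit.
Unset Printing Implicit Defensive.

Import Order.TTheory GRing.Theory Num.Theory.

(* Finite loopless undirected multigraphs: distinct edges may share their
   pair of ends. *)
Record mgraph := MGraph {
  vertex : finType;
  edge : finType;
  ends : edge -> {set vertex};
  card_ends : forall e, #|ends e| = 2
}.

(* No self-adjacency, since [set x; x] is a singleton. *)
Definition adjacent (G : mgraph) (x y : vertex G) : bool :=
  [exists e : edge G, ends e == [set x; y]%SET].

Definition neighbours (G : mgraph) (x : vertex G) : {set vertex G} :=
  [set y | adjacent x y]%SET.

Definition degree (G : mgraph) (x : vertex G) : nat := #|neighbours x|.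

(* A relation rather than a function, so that the graph without vertices has
   no minimum degree. *)
Definition has_min_degree (G : mgraph) (d : nat) : Prop :=
  (exists x : vertex G, degree x = d) /\ (forall x : vertex G, d <= degree x).

Definition embedding (H G : mgraph)
    (f : vertex H -> vertex G) (g : edge H -> edge G) : Prop :=
  [/\ injective f, injective g & forall e, ends (g e) = (f @: ends e)%SET].

(* Up to isomorphism, like the removals and contractions below. *)
Definition subgraph (H G : mgraph) : Prop :=
  exists f g, @embedding H G f g.

Definition isomorphic (H G : mgraph) : Prop :=
  exists f g, [/\ @embedding H G f g, bijective f & bijective g].

Definition vertex_removal (H G : mgraph) : Prop :=
  exists (v : vertex G) (f : vertex H -> vertex G) (g : edge H -> edge G),
    [/\ embedding f g,
        forall x, (x \in codom f) = (x != v)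
      & forall e, (e \in codom g) = (v \notin ends e)].

Definition edge_removal (H G : mgraph) : Prop :=
  exists (a : edge G) (f : vertex H -> vertex G) (g : edge H -> edge G),
    [/\ embedding f g,
        forall x, x \in codom f
      & forall e, (e \in codom g) = (e != a)].

(* Contracting a: the quotient map f identifies the two ends of a and nothing
   else; g injects the surviving edges, i.e. all those that do not become
   loops, so edges that become parallel are all kept. *)
Definition edge_contraction (H G : mgraph) : Prop :=
  exists (a : edge G) (f : vertex G -> vertex H) (g : edge H -> edge G),
    [/\ forall y, y \in codom f,
        forall x y, f x = f y <-> x = y \/ [set x; y]%SET = ends a,
        injective g,
        forall e, (e \in codom g) = (ends e != ends a)
      & forall e, ends e = (f @: ends (g e))%SET].

Inductive minor (H : mgraph) : mgraph -> Prop :=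
| minor_iso G : isomorphic H G -> minor H G
| minor_vertex_removal G G' : vertex_removal G' G -> minor H G' -> minor H G
| minor_edge_removal G G' : edge_removal G' G -> minor H G' -> minor H G
| minor_edge_contraction G G' :
    edge_contraction G' G -> minor H G' -> minor H G.

Definition is_model (H G M : mgraph) : Prop := subgraph M G /\ minor H M.

Section Girth.
Local Open Scope classical_set_scope.
Local Open Scope ereal_scope.

Definition model_size (H G : mgraph) (n : nat) : Prop :=
  exists M, is_model H G M /\ #|edge M| = n.

(* An infimum of natural numbers in the extended reals: it is a minimum when
   some H-model exists (lemma girth_min) and +oo otherwise. *)
Definition girth (R : realType) (H G : mgraph) : \bar R :=
  ereal_inf [set n%:R%:E | n in model_size H G].

Lemma girth_min (R : realType) (H G : mgraph) :
  (exists M, is_model H G M) ->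
  exists M, is_model H G M /\ girth R H G = (#|edge M|%:R)%:E.
Proof.
move=> [M0 M0P].
have exP : exists n, `[< model_size H G n >].
  by exists #|edge M0|; apply/asboolP; exists M0.
case: (ex_minnP exP) => n /asboolP[M [MP <-]] minM; exists M; split=> //.
apply/eqP; rewrite eq_le; apply/andP; split.
  by apply: ereal_inf_lbound; exists #|edge M| => //; exists M.
apply: le_ereal_inf_tmp => _ [m mP <-]; rewrite lee_fin ler_nat.
by apply: minM; apply/asboolP.
Qed.

Lemma girth_infty (R : realType) (H G : mgraph) :
  ~ (exists M, is_model H G M) -> girth R H G = +oo.
Proof.
move=> noM; apply/eqP; rewrite eq_le leey /=.
by apply: le_ereal_inf_tmp => y [n [M [MP _]] _]; case: noM; exists M.
Qed.

End Girth.

Lemma card_ends_theta r (e : 'I_r) : #|[set: 'I_2]%SET| = 2.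
Proof. by rewrite cardsT card_ord. Qed.

Definition theta (r : nat) : mgraph :=
  @MGraph 'I_2 'I_r (fun _ => [set: 'I_2]%SET) (@card_ends_theta r).

Lemma card_ends_clique k (e : {A : {set 'I_k} | #|A| == 2}) : #|val e| = 2.
Proof. exact: eqP (valP e). Qed.

Definition clique (k : nat) : mgraph :=
  @MGraph 'I_k {A : {set 'I_k} | #|A| == 2} val (@card_ends_clique k).

Definition log2 (R : realType) (x : R) : R := (ln x / ln 2)%R.

(* Main.v *)
Require Import Defs.
From mathcomp Require Import all_boot all_order all_algebra.
From mathcomp Require Import all_classical all_reals all_analysis.
From mathcomp Require Import zify lra.

(** Write x = d / r. The constant in the exponent is free, so it is enough to
    find a minor of [G] whose minimum degree is at least x ^ (Omega (z / r)),
    and then a clique minor whose order is a fixed power of that degree: no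
    sharp dependence of the clique order on the degree is required. The proof
    gives c = 1 / 80.

    The minor of large degree is obtained by contracting balls. Let rho be
    about z / (4 r), choose a maximal set of centres at pairwise distance more
    than 2 rho, and attach every vertex to a nearest centre along a tree of
    shortest paths, of depth at most 2 rho ([shallow_forest]). Each cell is
    connected and contains the ball of radius rho around its centre. If r edges
    joined two cells, these edges with the tree paths from their ends to the
    two roots would form a model of theta_r with at most r (4 rho + 1) < z
    edges; hence fewer than r edges join two cells ([few_cross_edges]). For the
    same reason a vertex has fewer than r neighbours in its own cell that are
    no farther than itself from the root ([few_neighbours_below]): contract the
    tree paths of these neighbours and keep the vertex as the other end of
    theta_r.

    Both facts are used by counting. Inside the ball of radius rho, a vertex of
    one layer sends at least d - r + 1 edges to the next layer and a vertex of
    the next layer receives at most r - 1, so layers grow by a factor of at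
    least x - 1 ([layer_growth]). A cell with m vertices spans at most (r - 1) m edges,
    so at least (d - 2 (r - 1)) m edges leave it, at most r - 1 of them to
    any given cell: it has at least (x - 2) m neighbouring cells
    ([cell_boundary]). The quotient therefore has minimum degree at least
    (x - 2) (x - 1) ^ rho ([quotient_minor]).

    The clique minor is found as Mader does ([clique_minor_of_size]): delete
    and contract while the density stays at least D. When this stops, some
    vertex has at most 2 D neighbours, and in the graph they induce all degrees
    are at least D. Among any three vertices of such a dense graph two have at
    least D / 3 common neighbours, so, by the Ramsey bound for graphs without
    independent triples, there are about sqrt D vertices that pairwise have that
    many, and these are joined through distinct common neighbours
    ([clique_minor_of_dense]). *)

Set Implicit Arguments.
Unset Strict Implicit.
Unset Printing Implicit Defensive.

(* Restores the graph meaning of names such as [adjacent]. *)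
Import Defs.
Import Order.TTheory GRing.Theory Num.Theory.

(** * Adjacency *)

Lemma adjacentP (G : mgraph) (x y : vertex G) :
  reflect (exists e : edge G, ends e = [set x; y]%SET) (adjacent x y).
Proof.
by apply: (iffP existsP) => [[e /eqP he]|[e he]]; exists e => //; apply/eqP.
Qed.

Lemma ends2 (G : mgraph) (e : edge G) :
  exists x y, x != y /\ ends e = [set x; y]%SET.
Proof.
have /eqP/cards2P[x [y [xy he]]] := card_ends e.
by exists x, y.
Qed.

Lemma adjacent_sym (G : mgraph) (x y : vertex G) : adjacent x y = adjacent y x.
Proof. by rewrite /adjacent; apply: eq_existsb => e; rewrite finset.setUC. Qed.

Lemma adjacent_irr (G : mgraph) (x : vertex G) : adjacent x x = false.
Proof.
apply/negbTE/negP => /adjacentP[e he]; have := card_ends e.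
by rewrite he finset.setUid cards1.
Qed.

Lemma adjacent_neq (G : mgraph) (x y : vertex G) : adjacent x y -> x != y.
Proof. by apply: contraTneq => ->; rewrite adjacent_irr. Qed.

Lemma val_imset_preim (T : finType) (P : pred T) (A : {set T}) :
  {in A, forall x, P x} ->
  (val @: [set x : {x | P x} | val x \in A] = A)%SET.
Proof.
move=> AP; apply/setP => x; apply/imsetP/idP => [[y + ->]|xA].
  by rewrite inE.
by exists (Sub x (AP x xA)); rewrite ?inE ?SubK.
Qed.

Lemma set2_inj (T : finType) (x y u v : T) :
  ([set x; y] = [set u; v])%SET -> (x = u /\ y = v) \/ (x = v /\ y = u).
Proof.
move=> E.
have: x \in [set u; v]%SET by rewrite -E !inE eqxx.
have: y \in [set u; v]%SET by rewrite -E !inE eqxx orbT.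
have: u \in [set x; y]%SET by rewrite E !inE eqxx.
have: v \in [set x; y]%SET by rewrite E !inE eqxx orbT.
rewrite !inE => /orP[]/eqP ? /orP[]/eqP ? /orP[]/eqP ? /orP[]/eqP ?; subst; auto.
Qed.

(** * Elementary minor operations *)

Section DeleteVertex.
Variables (G : mgraph) (v : vertex G).

Lemma ends_off (e : {e : edge G | v \notin ends e}) :
  {in ends (val e), forall x, x != v}.
Proof. by case: e => f /= vf x xf; apply: contraNneq vf => <-. Qed.

Lemma card_ends_del_vertex (e : {e : edge G | v \notin ends e}) :
  #|[set x : {x | x != v} | val x \in ends (val e)]%SET| = 2.
Proof.
rewrite -(card_imset _ val_inj) val_imset_preim ?card_ends //.
exact: ends_off.
Qed.

Definition del_vertex : mgraph := MGraph card_ends_del_vertex.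

Lemma ends_del_vertex (e : edge del_vertex) :
  ends (val e) = (val @: (ends e : {set {x | x != v}}))%SET.
Proof.
by rewrite val_imset_preim //; exact: ends_off.
Qed.

Lemma minor_del_vertex H : minor H del_vertex -> minor H G.
Proof.
apply: (@minor_vertex_removal _ _ del_vertex); exists v, val, val; split.
- by split; [exact: val_inj | exact: val_inj | exact: ends_del_vertex].
- move=> x; apply/codomP/idP => [[[y yP] ->] //|xv].
  by exists (exist _ x xv).
- move=> e; apply/codomP/idP => [[[y yP] ->] //|ev].
  by exists (exist _ e ev).
Qed.

Lemma adjacent_del_vertex (x y : vertex del_vertex) :
  adjacent x y = adjacent (G := G) (val x) (val y).
Proof.
apply/adjacentP/adjacentP => [[e he]|[e he]].
  by exists (val e); rewrite ends_del_vertex he imsetU !imset_set1.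
have ev : v \notin ends e.
  by rewrite he !inE negb_or; rewrite ![v == _]eq_sym (valP x) (valP y).
exists (Sub e ev); apply: (imset_inj val_inj).
by rewrite -ends_del_vertex SubK he imsetU !imset_set1.
Qed.
End DeleteVertex.

Section DeleteEdge.
Variables (G : mgraph) (a : edge G).

Lemma card_ends_del_edge (e : {e : edge G | e != a}) : #|ends (val e)| = 2.
Proof. exact: card_ends. Qed.

Definition del_edge : mgraph := MGraph card_ends_del_edge.

Lemma minor_del_edge H : minor H del_edge -> minor H G.
Proof.
apply: (@minor_edge_removal _ _ del_edge); exists a, id, val; split.
- by split=> [//||e]; [exact: val_inj | rewrite imset_id].
- by move=> x; apply/codomP; exists x.
- move=> e; apply/codomP/idP => [[[y yP] ->] //|ev].
  by exists (exist _ e ev).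
Qed.
End DeleteEdge.

Section Contract.
Variables (G : mgraph) (a : edge G) (x0 y0 : vertex G).
Hypotheses (x0y0 : x0 != y0) (ends_a : ends a = [set x0; y0]%SET).

Definition contr (x : vertex G) : {x | x != y0} := insubd (Sub x0 x0y0) x.

Lemma val_contr x : val (contr x) = if x == y0 then x0 else x.
Proof. by rewrite val_insubd; case: eqP. Qed.

Lemma contr_val x : contr (val x) = x.
Proof. by rewrite /contr valKd. Qed.

Lemma contr_eq x y : contr x = contr y <-> x = y \/ [set x; y]%SET = ends a.
Proof.
rewrite ends_a; split.
  move/(congr1 val); rewrite !val_contr.
  case: eqP => [->|_]; case: eqP => [->|_]; auto.
    by move=> <-; right; rewrite finset.setUC.
  by move=> ->; right.
move=> [->//|/set2_inj[[-> ->]|[-> ->]]]; apply: val_inj;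
  by rewrite !val_contr eqxx (negPf x0y0).
Qed.

Lemma card_ends_contract (e : {e : edge G | ends e != ends a}) :
  #|(contr @: ends (val e))%SET| = 2.
Proof.
case: e => e /= ne; have [u [w [uw E]]] := ends2 e.
rewrite E imsetU !imset_set1 cards2; case: eqP => // /contr_eq[/eqP|E'].
  by rewrite (negPf uw).
by rewrite -E' E eqxx in ne.
Qed.

Definition contract : mgraph := MGraph card_ends_contract.

Lemma minor_contract H : minor H contract -> minor H G.
Proof.
apply: (@minor_edge_contraction _ _ contract); exists a, contr, val; split => //.
- by move=> y; apply/codomP; exists (val y); rewrite contr_val.
- exact: contr_eq.
- move=> e; apply/codomP/idP => [[[y yP] ->] //|ev].
  by exists (exist _ e ev).
Qed.

Lemma adjacent_contr x y :
  adjacent x y -> contr x = contr y \/ adjacent (G := contract) (contr x) (contr y).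
Proof.
move=> /adjacentP[e he]; have [E|E] := eqVneq (ends e) (ends a).
  by left; apply/contr_eq; right; rewrite -he.
right; apply/adjacentP; exists (Sub e E).
by rewrite /= he imsetU !imset_set1.
Qed.
End Contract.

(** * Minors from branch sets *)

Lemma minor_refl G : minor G G.
Proof.
apply: minor_iso; exists id, id.
by split; [split=> // e; rewrite imset_id | exists id | exists id].
Qed.

Lemma embedding_comp F H G (f1 : vertex F -> vertex H) g1
    (f2 : vertex H -> vertex G) g2 :
  embedding f1 g1 -> embedding f2 g2 -> embedding (f2 \o f1) (g2 \o g1).
Proof.
move=> [f1i g1i E1] [f2i g2i E2]; split; try exact: inj_comp.
by move=> e; rewrite /= E2 E1 imset_comp.
Qed.

Lemma codom_comp_bij (A B C : finType) (f : A -> B) (h : B -> C) k y :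
  cancel h k -> cancel k h -> (y \in codom (h \o f)) = (k y \in codom f).
Proof.
move=> hK kK; apply/codomP/codomP => -[x E]; exists x; last by rewrite /= -E kK.
by rewrite E /= hK.
Qed.

(** Minors are defined by operations on concrete graphs; the first operation
    applied to [H] is transported along the isomorphism. *)
Lemma minor_isomorphic K H G : isomorphic H G -> minor K H -> minor K G.
Proof.
move=> + KH; case: KH => {}H;
  [move=> [f [g [fg fb gb]]]|move=> H' [v [f [g [fg cf cg]]]] HH'
  |move=> H' [a [f [g [fg cf cg]]]] HH'|move=> H' [a [f [g [cf ff gi cg Eg]]]] HH'];
  move=> [p [q [pq pb qb]]]; have [pi qi E] := pq;
  have [p' pK p'K] := pb; have [q' qK q'K] := qb.
- apply: minor_iso; exists (p \o f), (q \o g); split; try exact: bij_comp.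
  exact: embedding_comp.
- apply: minor_vertex_removal HH'; exists (p v), (p \o f), (q \o g); split.
  + exact: embedding_comp.
  + by move=> x; rewrite (codom_comp_bij _ _ pK p'K) cf (can2_eq p'K pK).
  + move=> e; rewrite (codom_comp_bij _ _ qK q'K) cg.
    by rewrite -{2}(q'K e) E (mem_imset _ _ pi).
- apply: minor_edge_removal HH'; exists (q a), (p \o f), (q \o g); split.
  + exact: embedding_comp.
  + by move=> x; rewrite (codom_comp_bij _ _ pK p'K) cf.
  + by move=> x; rewrite (codom_comp_bij _ _ qK q'K) cg (can2_eq q'K qK).
- apply: minor_edge_contraction HH'; exists (q a), (f \o p'), (q \o g); split.
  + by move=> y; have /codomP[x ->] := cf y; apply/codomP; exists (p x); rewrite /= pK.
  + move=> x y /=; rewrite E; split => [/ff[/(can_inj p'K)->|<-]|[->//|E']]; auto.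
      by right; rewrite imsetU !imset_set1 !p'K.
    apply/ff; right; apply: (imset_inj pi).
    by rewrite -E' imsetU !imset_set1 !p'K.
  + exact: inj_comp.
  + move=> e; rewrite (codom_comp_bij _ _ qK q'K) cg -{2}(q'K e) !E.
    by rewrite (inj_eq (imset_inj pi)).
  + move=> e; rewrite Eg /= E imset_comp; congr (f @: _)%SET.
    by rewrite -imset_comp (eq_imset _ pK) imset_id.
Qed.

Definition in_fibre (G : mgraph) (W : eqType) (phi : vertex G -> option W) :
  rel (vertex G) := fun x y => adjacent x y && (phi x == phi y).

(** The usual certificate for a minor: [phi] maps the branch set of each vertex
    of [H] to that vertex and the vertices in no branch set to [None]; [g] picks
    an edge of [G] for each edge of [H]. *)
Definition branch_model (H G : mgraph)
    (phi : vertex G -> option (vertex H)) (g : edge H -> edge G) : Prop :=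
  [/\ forall h, exists x, phi x = Some h,
      forall x y, phi x = phi y -> phi x -> connect (in_fibre phi) x y,
      injective g
    & forall e, (phi @: ends (g e) = Some @: ends e)%SET].

(** The three elementary operations lead from [G] to a copy of [H] by induction
    on the size of [G]: remove the vertices outside all branch sets, contract the
    edges inside branch sets, and remove the edges that [g] does not use.
    Carrying along a minor [K] of [H] makes branch models compose with minors. *)
Lemma branch_minor (K H G : mgraph)
    (phi : vertex G -> option (vertex H)) (g : edge H -> edge G) :
  branch_model phi g -> minor K H -> minor K G.
Proof.
move=> + KH.
have [n] := ubnP (#|vertex G| + #|edge G|).
elim: n => // n IHn in G phi g * => ltGn [phi_onto phi_conn g_inj g_ends].
have [[v phiv]|no_None] := pselect (exists v, phi v = None).
  (* a vertex outside every branch set is removed *)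
  apply: (@minor_del_vertex G v).
  have gv e : v \notin ends (g e).
    apply/negP => ve; have: phi v \in (phi @: ends (g e))%SET by apply: imset_f.
    by rewrite g_ends phiv => /imsetP[].
  pose phi' (x : vertex (del_vertex v)) := phi (val x).
  pose g' e : edge (del_vertex v) := exist _ (g e) (gv e).
  apply: (IHn _ phi' g').
    rewrite ltnS in ltGn; apply: leq_trans ltGn.
    rewrite -addSn; apply: leq_add.
      by rewrite card_sig; have := cardC1 v; rewrite -(cardC (pred1 v)) card1 => ->.
    by rewrite card_sig; apply: max_card.
  split.
  - move=> h; have [x xh] := phi_onto h.
    have xv : x != v by apply: contra_eqN xh => /eqP->; rewrite phiv.
    by exists (exist _ x xv).
  - move=> x y; rewrite /phi' => xy phix.
    have /connectP[p] := phi_conn _ _ xy phix.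
    elim: p => [|z p IHp] in x xy phix * => /= [_ E|].
      by have -> : x = y by apply: val_inj.
    case/andP=> /andP[xz /eqP Exz] zp E.
    have zv : z != v by apply: contraTneq phix => zv; rewrite Exz zv phiv.
    apply: (@connect_trans _ _ (exist _ z zv : vertex (del_vertex v))).
      by apply: connect1; rewrite /in_fibre adjacent_del_vertex xz /phi' /= Exz /=.
    by apply: IHp; rewrite /= -?Exz.
  - by move=> e1 e2 /(congr1 val) /=; apply: g_inj.
  - move=> e; rewrite -g_ends; rewrite -[g e]/(val (g' e)).
    by rewrite (ends_del_vertex (g' e)) -imset_comp.
have phi_some x : exists h, phi x = Some h.
  by case E: (phi x) => [h|]; [exists h | case: no_None; exists x].
have gxy e x y : ends (g e) = [set x; y]%SET -> phi x != phi y.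
  move=> exy; have := g_ends e.
  have [u [w [uw ->]]] := ends2 e; rewrite exy !imsetU !imset_set1 => E.
  by case: (set2_inj E) => -[-> ->]; rewrite (inj_eq Some_inj) // eq_sym.
have [[a [x0 [y0 [x0y0 [ea Ea]]]]]|no_inner] :=
    pselect (exists a x0 y0, x0 != y0 /\ ends a = [set x0; y0]%SET /\ phi x0 = phi y0).
  (* an edge inside a branch set is contracted *)
  apply: (@minor_contract G a x0 y0 x0y0 ea).
  have ga e : ends (g e) != ends a.
    by apply: contra_eq_neq Ea => E; apply: (gxy e); rewrite E.
  pose phi' (x : vertex (contract x0y0 ea)) := phi (val x).
  pose g' e : edge (contract x0y0 ea) := exist _ (g e) (ga e).
  have phi'E x : phi' (contr x0y0 x) = phi x.
    by rewrite /phi' val_contr; case: eqP => // ->.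
  apply: (IHn _ phi' g').
    rewrite ltnS in ltGn; apply: leq_trans ltGn.
    rewrite -addSn; apply: leq_add.
      by rewrite card_sig -(cardC (pred1 y0)) card1.
    by rewrite card_sig; apply: max_card.
  split.
  - by move=> h; have [x xh] := phi_onto h; exists (contr x0y0 x); rewrite phi'E.
  - move=> x y; rewrite -(contr_val x0y0 x) -(contr_val x0y0 y) !phi'E.
    move: (val x) (val y) => {}x {}y xy phix.
    have /connectP[p] := phi_conn _ _ xy phix.
    elim: p => [|z p IHp] in x xy phix * => /= [_ -> //|].
    case/andP=> /andP[xz /eqP Exz] zp E.
    apply: (@connect_trans _ _ (contr x0y0 z)); last by apply: IHp; rewrite -?Exz.
    have [->|xz'] := adjacent_contr x0y0 ea xz; first exact: connect0.
    by apply: connect1; rewrite /in_fibre xz' !phi'E Exz /=.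
  - by move=> e1 e2 /(congr1 val) /=; apply: g_inj.
  - move=> e; rewrite -g_ends /= -imset_comp.
    by apply: eq_imset => x; apply: phi'E.
have phi_inj : injective phi.
  move=> x y xy; have [h xh] := phi_some x.
  have phix : phi x by rewrite xh.
  have /connectP[[|z p] /=] := phi_conn _ _ xy phix.
    by move=> _ ->.
  case/andP=> /andP[xz /eqP Exz] _ _; case: no_inner.
  have /adjacentP[e he] := xz.
  by exists e, x, z; rewrite (adjacent_neq xz).
have [[a aP]|g_onto] := pselect (exists a, a \notin codom g).
  (* an edge of G standing for no edge of H is deleted *)
  apply: (@minor_del_edge G a).
  have ga e : g e != a by apply: contraNneq aP => <-; apply: codom_f.
  pose g' e : edge (del_edge a) := exist _ (g e) (ga e).
  apply: (IHn _ (phi : vertex (del_edge a) -> _) g').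
    rewrite ltnS in ltGn; apply: leq_trans ltGn.
    by rewrite -addnS leq_add2l card_sig -(cardC (pred1 a)) card1.
  split => //.
  - by move=> x y /phi_inj -> _; apply: connect0.
  - by move=> e1 e2 /(congr1 val) /=; apply: g_inj.
have [f fP] := choice phi_onto.
apply: minor_isomorphic KH; exists f, g; split.
- split=> //.
  + by move=> h1 h2 /(congr1 phi); rewrite !fP => -[].
  + move=> e; apply: (imset_inj phi_inj); rewrite g_ends -imset_comp.
    by apply: eq_imset => h; rewrite /= fP.
- have [s sP] := choice phi_some; exists s => x; last first.
    by apply: phi_inj; rewrite fP sP.
  by apply: Some_inj; rewrite -sP fP.
- have g_sec a : exists e, g e = a.
    case: (boolP (a \in codom g)) => [/codomP[e ->]|na]; first by exists e.
    by case: g_onto; exists a.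
  have [s sP] := choice g_sec.
  by exists s => // e; apply: g_inj; rewrite sP.
Qed.

Lemma in_fibre_sym (G : mgraph) (W : eqType) (phi : vertex G -> option W) :
  symmetric (in_fibre phi).
Proof. by move=> x y; rewrite /in_fibre adjacent_sym eq_sym. Qed.

(** It is enough to connect each vertex of a branch set to one chosen vertex of
    that branch set. *)
Lemma rooted_fibres (G : mgraph) (W : eqType) (phi : vertex G -> option W)
    (c : W -> vertex G) :
  (forall h x, phi x = Some h -> connect (in_fibre phi) x (c h)) ->
  forall x y, phi x = phi y -> phi x -> connect (in_fibre phi) x y.
Proof.
move=> conn x y xy; case E: (phi x) => [h|] // _.
apply: connect_trans (conn h x E) _.
rewrite (sym_connect_sym (@in_fibre_sym _ _ phi)).
by apply: conn; rewrite -xy.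
Qed.

(** When [H] has no parallel edges the choice of edges is automatically
    injective, since an edge of [H] can be read off from its ends. *)
Lemma branch_model_simple (H G : mgraph) (phi : vertex G -> option (vertex H)) :
  injective (@ends H) ->
  (forall h, exists x, phi x = Some h) ->
  (forall x y, phi x = phi y -> phi x -> connect (in_fibre phi) x y) ->
  (forall e : edge H, exists x y, adjacent x y /\
     ([set phi x; phi y] = Some @: ends e)%SET) ->
  exists g, branch_model phi g.
Proof.
move=> simpleH onto conn adjH.
have [g gP] : {g : edge H -> edge G & forall e, (phi @: ends (g e) = Some @: ends e)%SET}.
  apply: (@choice _ _ (fun e a => phi @: ends a = Some @: ends e)%SET) => e.
  have [x [y [/adjacentP[a ha] E]]] := adjH e.
  by exists a; rewrite ha imsetU !imset_set1.
exists g; split=> // e1 e2 E; apply: simpleH.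
by apply: (imset_inj (@Some_inj _)); rewrite -!gP E.
Qed.

(** * Two greedy arguments *)

(** A crude form of Hall's theorem: with sets as large as the whole family, one
    can choose representatives one after the other. *)
Lemma greedy_sdr (I T : finType) (A : I -> {set T}) :
  (forall i, #|I| <= #|A i|) ->
  exists w : I -> T, injective w /\ forall i, w i \in A i.
Proof.
move=> large.
have [w0 w0P] : {w : I -> T & forall i, w i \in A i}.
  apply: (@choice _ _ (fun i y => y \in A i)) => i; apply/existsP.
  have : 0 < #|A i| by apply: leq_trans (large i); apply/card_gt0P; exists i.
  by move=> /card_gt0P[y yA]; apply/existsP; exists y.
suff [w [wi wA]] : exists w : I -> T,
    {in enum I &, injective w} /\ forall i, w i \in A i.
  by exists w; split=> // i j; apply: wi; rewrite mem_enum.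
have : size (enum I) <= #|I| by rewrite cardE.
have := enum_uniq I.
elim: (enum I) => [|i s IHs] /=; first by exists w0.
case/andP=> i_s us ltsI; have [w [wi wA]] := IHs us (ltnW ltsI).
have [y] : exists y, y \in A i :\: [set w j | j in s].
  apply/set0Pn; rewrite -card_gt0 cardsD subn_gt0.
  apply: leq_ltn_trans (subset_leq_card (finset.subsetIr _ _)) _.
  apply: leq_ltn_trans (leq_imset_card _ _) _.
  apply: leq_ltn_trans (card_size _) _.
  exact: leq_trans ltsI (large i).
rewrite inE => /andP[yw yA].
have yNw j : j \in s -> y != w j.
  by apply: contraTneq => E; apply: contra yw => js; rewrite E imset_f.
exists (fun j => if j == i then y else w j); split; last by move=> j; case: eqP => [->|].
move=> j1 j2; rewrite !inE.
case: eqP => [->|_] /=; case: eqP => [->|_] //= j1s j2s E.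
- by have := yNw _ j2s; rewrite E eqxx.
- by have := yNw _ j1s; rewrite E eqxx.
- exact: wi.
Qed.

Lemma card_bigcup_le (I T : finType) (A : {set I}) (F : I -> {set T}) :
  #|(\bigcup_(i in A) F i)%SET| <= \sum_(i in A) #|F i|.
Proof.
elim/big_ind2: _ => [|X a Y b leX leY|//]; first by rewrite cards0.
by apply: leq_trans (leq_add leX leY); rewrite leq_card_setU.
Qed.

(** If some [x] is unrelated to at least [k] elements, these are pairwise
    related, as two unrelated ones would form a bad triple with [x]. Otherwise
    each chosen element rules out at most [k] elements, itself included, and a
    greedy choice does not get stuck before [k] steps. *)
Lemma ramsey_no_independent_triple (T : finType) (r : rel T) (N : {set T}) k :
  symmetric r -> {in N, reflexive r} ->
  {in N & &, forall x y w, [|| r x y, r x w | r y w]} ->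
  k ^ 2 <= #|N| ->
  exists U : {set T}, [/\ U \subset N, k <= #|U| & {in U &, forall x y, r x y}].
Proof.
move=> r_sym r_refl no3 leN.
pose far x := [set y in N | ~~ r x y].
have [[x [xN lex]]|few] := pselect (exists x, x \in N /\ k <= #|far x|).
  exists (far x); split=> //; first by apply/fintype.subsetP => y; rewrite inE => /andP[].
  move=> y w; rewrite !inE => /andP[yN /negPf rxy] /andP[wN /negPf rxw].
  by have := no3 _ _ _ xN yN wN; rewrite rxy rxw.
have : k <= k by [].
(* Clique sizes [j <= k] are reached one by one. *)
elim: {1 3}k => [|j IHj] ltjk.
  by exists finset.set0; split; rewrite ?finset.sub0set // => x y; rewrite inE.
have [U [UN leU rU]] := IHj (ltnW ltjk).
have [leU'|gtU] := leqP j.+1 #|U|; first by exists U.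
have cU : #|U| = j by apply/eqP; rewrite eqn_leq leU -ltnS gtU.
pose bad := (\bigcup_(u in U) (u |: far u))%SET.
have le_bad : #|bad| <= j * k.
  apply: leq_trans (card_bigcup_le _ _) _; rewrite -cU -sum_nat_const.
  apply: leq_sum => u uU.
  rewrite cardsU1; apply: (@leq_trans #|far u|.+1); last first.
    rewrite ltnNge; apply/negP => le; apply: few; exists u.
    by rewrite (fintype.subsetP UN).
  by rewrite -add1n leq_add2r leq_b1.
have [y] : exists y, y \in N :\: bad.
  apply/set0Pn; rewrite -card_gt0 cardsD subn_gt0.
  apply: leq_ltn_trans (subset_leq_card (finset.subsetIr _ _)) _.
  apply: leq_ltn_trans le_bad _; apply: leq_trans leN.
  by rewrite -mulnn ltn_mul2r ltjk (leq_ltn_trans _ ltjk).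
rewrite inE => /andP[/bigcupP nbad yN].
have rUy u : u \in U -> u != y /\ r u y.
  move=> uU; have ny : y \notin u |: far u by apply/negP => ?; apply: nbad; exists u.
  by move: ny; rewrite !inE negb_or yN /= negbK eq_sym => /andP.
exists (y |: U); split.
- by rewrite finset.subUset finset.sub1set yN.
- rewrite cardsU1 cU; suff -> : y \notin U by [].
  by apply/negP => /rUy[]; rewrite eqxx.
- move=> x w; rewrite !inE => /orP[/eqP->|xU] /orP[/eqP->|wU].
  + exact: r_refl.
  + by rewrite r_sym; case: (rUy _ wU).
  + by case: (rUy _ xU).
  + exact: rU.
Qed.

Lemma injection_into_set (T : finType) (A : {set T}) r :
  r <= #|A| -> exists t : 'I_r -> T, injective t /\ forall i, t i \in A.
Proof.
case: r => [|r] leA.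
  have f : 'I_0 -> T by case.
  by exists f; split; case.
have [x0 x0A] : exists x, x \in A by apply/card_gt0P; apply: leq_trans leA.
have lt_enum (i : 'I_r.+1) : i < size (enum A).
  by rewrite -cardE; apply: leq_trans leA.
exists (fun i => nth x0 (enum A) i); split=> [i j /eqP|i].
  rewrite nth_uniq ?enum_uniq // => /eqP; exact: ord_inj.
by rewrite -mem_enum mem_nth.
Qed.

(** * Clique minors in dense graphs *)

Lemma clique_ends_inj k : injective (@ends (clique k)).
Proof. exact: val_inj. Qed.

(** The branch set of [i] is the star formed by [u i] and all [w (i, j)]; the
    vertex [w (i, j)] is adjacent to [u j]. *)
Lemma clique_minor_of_connectors (G : mgraph) k (u : 'I_k -> vertex G)
    (w : 'I_k * 'I_k -> vertex G) :
  injective u -> injective w -> (forall p i, w p != u i) ->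
  (forall p, adjacent (u p.1) (w p) && adjacent (u p.2) (w p)) ->
  minor (clique k) G.
Proof.
move=> ui wi wu adj.
pose phi x : option (vertex (clique k)) :=
  if [pick i | u i == x] is Some i then Some i
  else if [pick p | w p == x] is Some p then Some p.1 else None.
have phi_u i : phi (u i) = Some i.
  rewrite /phi; case: pickP => [j /eqP /ui -> //|/(_ i)]; by rewrite eqxx.
have phi_w p : phi (w p) = Some p.1.
  rewrite /phi; case: pickP => [j /eqP E|_]; first by have := wu p j; rewrite E eqxx.
  by case: pickP => [q /eqP /wi -> //|/(_ p)]; rewrite eqxx.
have phiP x h : phi x = Some h -> x = u h \/ exists2 p, x = w p & h = p.1.
  rewrite /phi; case: pickP => [i /eqP <- [->]|_]; first by left.
  by case: pickP => [p /eqP <- [<-]|//]; right; exists p.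
have [||||g gP] := @branch_model_simple (clique k) G phi.
- exact: clique_ends_inj.
- by move=> h; exists (u h).
- apply: (rooted_fibres (c := u)) => h x /phiP[->|[p -> ->]]; first exact: connect0.
  apply: connect1; rewrite /in_fibre phi_w phi_u eqxx andbT adjacent_sym.
  by case/andP: (adj p).
- move=> e; have [i [j [ij E]]] := ends2 e.
  exists (w (i, j)), (u j); rewrite phi_w phi_u E imsetU !imset_set1; split=> //.
  by rewrite adjacent_sym; case/andP: (adj (i, j)).
apply: (branch_minor gP); exact: minor_refl.
Qed.

(** Three subsets of [N] of size at least [D] in a set of size at most [2 * D]
    overlap: the sizes of their pairwise intersections sum to at least [D]. So
    among three vertices of [N] two have at least [D / 3] common neighbours, and
    Ramsey yields [k] vertices that pairwise do. As [D / 3 >= 2 * k ^ 2], enough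
    common neighbours remain to join all pairs disjointly. *)
Lemma clique_minor_of_dense (G : mgraph) (N : {set vertex G}) k D :
  0 < k -> 6 * k ^ 2 <= D -> #|N| <= 2 * D -> N != finset.set0 ->
  (forall x, x \in N -> D <= #|neighbours x :&: N|) ->
  minor (clique k) G.
Proof.
move=> k0 leD leN N0 degN.
pose c x y := #|(neighbours x :&: N) :&: (neighbours y :&: N)|.
have [||||U [UN leU closeU]] :=
  @ramsey_no_independent_triple _ [rel x y | D <= 3 * c x y] N k.
- by move=> x y /=; rewrite /c finset.setIC.
- by move=> x xN /=; rewrite /c finset.setIid; have := degN x xN; lia.
- move=> x y z xN yN zN /=; rewrite /c.
  set X := neighbours x :&: N; set Y := neighbours y :&: N.
  set Z := neighbours z :&: N.
  have leX : D <= #|X| by apply: degN.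
  have leY : D <= #|Y| by apply: degN.
  have leZ : D <= #|Z| by apply: degN.
  have XY := cardsUI X Y; have XYZ := cardsUI (X :|: Y) Z.
  have le1 : #|X :|: Y :|: Z| <= #|N|.
    by apply: subset_leq_card; rewrite !finset.subUset !finset.subsetIr.
  have le2 : #|(X :|: Y) :&: Z| <= #|X :&: Z| + #|Y :&: Z|.
    by rewrite finset.setIUl leq_card_setU.
  have [//|lt1] := leqP D (3 * #|X :&: Y|).
  have [//|lt2] := leqP D (3 * #|X :&: Z|).
  have [//|lt3] := leqP D (3 * #|Y :&: Z|).
  by clear - leN leX leY leZ XY XYZ le1 le2 lt1 lt2 lt3; lia.
- have [x xN] : exists x, x \in N by apply/set0Pn.
  have := subset_leq_card (finset.subsetIr (neighbours x) N); have := degN x xN.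
  by move: leD; lia.
have [u [ui uU]] := injection_into_set leU.
pose A (p : 'I_k * 'I_k) :=
  (neighbours (u p.1) :&: neighbours (u p.2)) :\: [set u i | i in 'I_k].
have [|w [wi wA]] := @greedy_sdr _ _ A.
  move=> p; rewrite card_prod card_ord.
  have := closeU _ _ (uU p.1) (uU p.2); rewrite /= => close.
  have cI : c (u p.1) (u p.2) <= #|neighbours (u p.1) :&: neighbours (u p.2)|.
    apply: subset_leq_card; apply/fintype.subsetP => y.
    by rewrite !inE => /andP[/andP[-> _] /andP[-> _]].
  have cu : #|[set u i | i in 'I_k]| = k by rewrite card_imset // card_ord.
  have cA := cardsID [set u i | i in 'I_k] (neighbours (u p.1) :&: neighbours (u p.2)).
  have cAu := subset_leq_card (finset.subsetIr
    (neighbours (u p.1) :&: neighbours (u p.2)) [set u i | i in 'I_k]).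
  rewrite -/(A p) in cA; rewrite cu in cAu.
  have kk : k <= k * k by rewrite leq_pmull.
  move: leD; rewrite -mulnn; move: (k * k) kk => K kk leD.
  move: (c _ _) (#|A p|) close cI cA => a b close cI cA.
  by lia.
apply: (clique_minor_of_connectors ui wi) => [p i|p]; have := wA p; rewrite !inE.
  by case/andP=> [np _]; apply: contra np => /eqP->; apply: imset_f.
by case/andP.
Qed.

(** * Clique minors from average degree *)

(** Density is measured by ordered adjacent pairs, hence regardless of parallel
    edges. *)
Definition adjset (G : mgraph) : {set vertex G * vertex G} :=
  [set p | adjacent p.1 p.2]%SET.

Lemma in_adjset (G : mgraph) (x y : vertex G) : ((x, y) \in adjset G) = adjacent x y.
Proof. by rewrite inE. Qed.

Lemma sum_degree (G : mgraph) : \sum_(x : vertex G) degree x = #|adjset G|.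
Proof.
rewrite -sum1_card (eq_bigl (fun p => adjacent p.1 p.2)); last by move=> p; rewrite inE.
rewrite -(pair_big_dep xpredT (@adjacent G) (fun _ _ => 1)) /=.
apply: eq_bigr => x _; rewrite /degree -sum1_card.
by apply: eq_bigl => y; rewrite inE.
Qed.

Lemma card_adjset_del_edge (G : mgraph) (a : edge G) :
  #|adjset G| <= 2 + #|adjset (del_edge a)|.
Proof.
have [u [v [_ ea]]] := ends2 a.
suff sub : adjset G \subset [set (u, v); (v, u)] :|: adjset (del_edge a).
  apply: leq_trans (subset_leq_card sub) _; apply: leq_trans (leq_card_setU _ _) _.
  by rewrite leq_add2r cards2 ltnS leq_b1.
apply/fintype.subsetP => -[x y]; rewrite !inE /= => /adjacentP[e he].
have [E|ne] := eqVneq e a.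
  move: he; rewrite E ea => /set2_inj[[-> ->]|[-> ->]]; by rewrite eqxx ?orbT.
apply/orP; right; apply/adjacentP; by exists (exist _ e ne).
Qed.

Lemma card_adjset_del_vertex (G : mgraph) (v : vertex G) :
  #|adjset G| <= 2 * degree v + #|adjset (del_vertex v)|.
Proof.
pose f (p : vertex (del_vertex v) * vertex (del_vertex v)) : vertex G * vertex G :=
  (val p.1, val p.2).
have sub : adjset G \subset
    ([set (v, y) | y in neighbours v] :|: [set (y, v) | y in neighbours v])
      :|: f @: adjset (del_vertex v).
  apply/fintype.subsetP => -[x y]; rewrite !inE /= => xy.
  have [E|xv] := eqVneq x v.
    apply/orP; left; apply/orP; left; apply/imsetP; exists y; rewrite ?E //.
    by rewrite inE -E.
  have [E|yv] := eqVneq y v.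
    apply/orP; left; apply/orP; right; apply/imsetP; exists x; rewrite ?E //.
    by rewrite inE adjacent_sym -E.
  apply/orP; right; apply/imsetP.
  exists (exist _ x xv : vertex (del_vertex v), exist _ y yv : vertex (del_vertex v)) => //.
  by rewrite inE adjacent_del_vertex.
apply: leq_trans (subset_leq_card sub) _; apply: leq_trans (leq_card_setU _ _) _.
apply: leq_add; last exact: leq_imset_card.
apply: leq_trans (leq_card_setU _ _) _.
by rewrite mul2n -addnn; apply: leq_add; apply: leq_imset_card.
Qed.

(** Contracting [x0 y0] loses the pair itself and merges the edges from [x0] and
    [y0] to each common neighbour; every other pair survives. *)
Lemma card_adjset_contract (G : mgraph) (a : edge G) x0 y0 (x0y0 : x0 != y0)
    (ea : ends a = [set x0; y0]%SET) :
  #|adjset G| <= 2 * #|neighbours x0 :&: neighbours y0|.+1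
                 + #|adjset (contract x0y0 ea)|.
Proof.
(* The pairs lost are those of [y0] with [x0] and with the common neighbours. *)
pose lost := (x0 |: (neighbours x0 :&: neighbours y0))%SET.
pose bad := ([set (y0, w) | w in lost] :|: [set (w, y0) | w in lost])%SET.
pose f (p : vertex G * vertex G) : vertex (contract x0y0 ea) * vertex (contract x0y0 ea) :=
  (contr x0y0 p.1, contr x0y0 p.2).
pose good x y := (x = y0 -> y \notin lost) /\ (y = y0 -> x \notin lost).
have badP x y : (x, y) \notin bad -> good x y.
  rewrite inE negb_or => /andP[n1 n2]; split=> E; rewrite E in n1 n2.
    by apply: contra n1 => ?; apply: imset_f.
  by apply: contra n2 => ?; apply: (imset_f (fun z => (z, y0))).
have lostP x : x \in lost = (x == x0) || (adjacent x0 x && adjacent y0 x).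
  by rewrite !inE.
have lef : #|adjset G :\: bad| <= #|adjset (contract x0y0 ea)|.
  rewrite -(card_in_imset (f := f)).
    apply: subset_leq_card; apply/fintype.subsetP => _ /imsetP[[x y] + ->].
    rewrite finset.in_setD !in_adjset => /andP[/badP[nx ny] xy].
    have [/(contr_eq x0y0 ea)[E|]|//] := adjacent_contr x0y0 ea xy.
      by rewrite E adjacent_irr in xy.
    rewrite ea => /set2_inj[[E1 E2]|[E1 E2]].
      by have := ny E2; rewrite E1 lostP eqxx.
    by have := nx E1; rewrite E2 lostP eqxx.
  have absurd y y' : good x0 y -> good y0 y' -> adjacent x0 y -> adjacent y0 y' ->
      contr x0y0 y = contr x0y0 y' -> False.
    move=> _ [gy _] xy xy'; have := gy erefl; rewrite lostP xy' andbT negb_or.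
    case/andP=> y'x0 n0 /(contr_eq x0y0 ea)[E|]; first by rewrite -E xy in n0.
    rewrite ea => /set2_inj[[_ E]|[_ E]].
      by rewrite E adjacent_irr in xy'.
    by rewrite E eqxx in y'x0.
  have key x y x' y' : good x y -> good x' y' -> adjacent x y -> adjacent x' y' ->
      contr x0y0 x = contr x0y0 x' -> contr x0y0 y = contr x0y0 y' -> x = x'.
    move=> g g' xy xy' /(contr_eq x0y0 ea)[//|]; rewrite ea => /set2_inj[[E1 E2]|[E1 E2]];
      rewrite E1 in g xy; rewrite E2 in g' xy'.
      by move/(absurd _ _ g g' xy xy').
    by move/esym/(absurd _ _ g' g xy' xy).
  have goodC x y : good x y -> good y x by case.
  move=> [x y] [x' y']; rewrite !finset.in_setD !in_adjset => /andP[/badP b xy].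
  move=> /andP[/badP b' xy'] [E1 E2].
  congr (_, _); first exact: (key _ _ _ _ b b' xy xy').
  by apply: (key y x y' x'); rewrite 1?adjacent_sym //; apply: goodC.
rewrite -(cardsID bad (adjset G)); apply: leq_add lef.
apply: leq_trans (subset_leq_card (finset.subsetIr _ _)) _.
apply: leq_trans (leq_card_setU _ _) _.
rewrite mul2n -addnn; apply: leq_add; apply: leq_trans (leq_imset_card _ _) _;
  by rewrite cardsU1 -add1n leq_add2r leq_b1.
Qed.

(** A graph to which no deletion or contraction applies without falling below
    density [D] has a dense neighbourhood: its average degree is below
    [2 * D + 1], which gives a vertex [v] of degree at most [2 * D], and every
    edge [v x] lies in at least [D] triangles. *)
Lemma clique_minor_of_size (G : mgraph) k D :
  0 < k -> 6 * k ^ 2 <= D -> 0 < #|vertex G| ->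
  2 * D * #|vertex G| <= \sum_(x : vertex G) degree x -> minor (clique k) G.
Proof.
move=> k0 leD; have D0 : 0 < D by apply: leq_trans leD; rewrite muln_gt0 expn_gt0 k0.
have [n] := ubnP (#|vertex G| + #|edge G|).
elim: n => // n IHn in G * => ltGn V0; rewrite sum_degree => dense.
have adj0 : 0 < #|adjset G|.
  by apply: leq_trans dense; rewrite !muln_gt0 D0 V0.
have [[v lev]|deg_gt] := pselect (exists v : vertex G, degree v <= D).
  have cV : #|vertex (del_vertex v)|.+1 = #|vertex G|.
    by rewrite card_sig -(cardC (pred1 v)) card1.
  have cE : #|edge (del_vertex v)| <= #|edge G| by rewrite card_sig; apply: max_card.
  have le := card_adjset_del_vertex v.
  apply: (@minor_del_vertex G v); apply: IHn.
  - by rewrite ltnS -cV in ltGn; apply: leq_trans ltGn; rewrite addSn ltnS leq_add2l.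
  - rewrite -ltnS cV ltnNge; apply/negP => V1.
    have : #|adjset G| <= 0.
      rewrite leqn0 cards_eq0; apply/eqP/setP => -[x y]; rewrite !inE /=.
      have /fintype_le1P V1' := V1.
      by rewrite (V1' x y) adjacent_irr.
    by rewrite leqNgt adj0.
  - rewrite sum_degree; move: dense; rewrite -cV mulnS.
    by move: (2 * D * _) => m; lia.
(* Removing an edge costs at most two ordered pairs. *)
have [slack|tight] := leqP (2 * D * #|vertex G| + 2) #|adjset G|.
  have [[x y]] : exists p, p \in adjset G by apply/card_gt0P.
  rewrite inE /= => /adjacentP[a _].
  have cE : #|edge (del_edge a)|.+1 = #|edge G|.
    by rewrite card_sig -(cardC (pred1 a)) card1.
  have le := card_adjset_del_edge a.
  apply: (@minor_del_edge G a); apply: IHn.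
  - by rewrite -ltnS -addnS cE.
  - exact: V0.
  - by rewrite sum_degree -(leq_add2l 2); apply: leq_trans le; rewrite addnC.
have [[x [y [xy few]]]|many] := pselect (exists x y : vertex G,
    adjacent x y /\ #|neighbours x :&: neighbours y| < D).
  have [a ea] := adjacentP _ _ xy; have xNy := adjacent_neq xy.
  have cV : #|vertex (contract xNy ea)|.+1 = #|vertex G|.
    by rewrite card_sig -(cardC (pred1 y)) card1.
  have cE : #|edge (contract xNy ea)| <= #|edge G| by rewrite card_sig; apply: max_card.
  have le := card_adjset_contract xNy ea.
  apply: (@minor_contract G a x y xNy ea); apply: IHn.
  - by rewrite ltnS -cV in ltGn; apply: leq_trans ltGn; rewrite addSn ltnS leq_add2l.
  - by apply/card_gt0P; exists (contr xNy x).
  - rewrite sum_degree; move: dense; rewrite -cV mulnS.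
    by move: (2 * D * _) => m; lia.
have [v lev] : exists v : vertex G, degree v <= 2 * D.
  apply: contrapT => nov.
  have gt (v : vertex G) : 2 * D < degree v.
    by rewrite ltnNge; apply/negP => ?; apply: nov; exists v.
  have le : #|vertex G| * (2 * D).+1 <= #|adjset G|.
    by rewrite -sum_nat_const -sum_degree; apply: leq_sum.
  have V1 : #|vertex G| <= 1.
    move: tight le; rewrite mulnS [2 * D * _]mulnC.
    by move: (#|vertex G| * (2 * D)) => m; lia.
  have [x _] := card_gt0P V0.
  have := leq_trans (gt x) (leq_trans (max_card (mem (neighbours x))) V1).
  by rewrite ltnS leqn0 muln_eq0 /= -leqn0 leqNgt D0.
have [y vy] : exists y, y \in neighbours v.
  apply/card_gt0P; rewrite lt0n; apply/negP => /eqP E; apply: deg_gt.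
  by exists v; rewrite /degree E.
apply: (clique_minor_of_dense (N := neighbours v) k0 leD lev).
  by apply/set0Pn; exists y.
move=> x; rewrite inE => vx; rewrite finset.setIC leqNgt; apply/negP => lt.
by apply: many; exists v, x.
Qed.

(** * Small theta models in a shallow forest *)

Section ThetaModel.
Variables (G : mgraph) (r z : nat).
Hypothesis girth_ge : forall M, is_model (theta r) G M -> z <= #|edge M|.

Lemma card_ends_span (F : {set edge G}) (e : {e | e \in F}) : #|ends (val e)| = 2.
Proof. exact: card_ends. Qed.

Definition span (F : {set edge G}) : mgraph := MGraph (@card_ends_span F).

Lemma subgraph_span F : subgraph (span F) G.
Proof. by exists id, val; split=> [//||e]; [exact: val_inj | rewrite imset_id]. Qed.

Lemma card_edge_span F : #|edge (span F)| = #|F|.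
Proof. by rewrite card_sig; apply: eq_card => e; rewrite inE. Qed.

Section Forest.
Variables (p : vertex G -> vertex G) (h : vertex G -> nat).
Hypothesis p_adj : forall x, 0 < h x -> adjacent x (p x).
Hypothesis h_p : forall x, 0 < h x -> h (p x) = (h x).-1.

(** Two disjoint trees joined by [r] edges contract to theta_r; the model has
    these [r] edges and one parent edge for each vertex that is not a root. *)
Lemma theta_from_trees (e : 'I_r -> edge G) (A B : {set vertex G}) a b :
  0 < r -> injective e -> [disjoint A & B] -> a \in A -> b \in B ->
  {in A, forall y, y != a -> 0 < h y /\ p y \in A} ->
  {in B, forall y, y != b -> 0 < h y /\ p y \in B} ->
  (forall i, exists s t, [/\ ends (e i) = [set s; t]%SET, s \in A & t \in B]) ->
  z <= r + #|A :\ a :|: B :\ b|.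
Proof.
move=> r0 ei dAB aA bB treeA treeB eAB; set W := _ :|: _.
pose phi y : option 'I_2 :=
  if y \in A then Some ord0 else if y \in B then Some ord_max else None.
pose c (i : 'I_2) := if i == ord0 then a else b.
have phiA y : y \in A -> phi y = Some ord0 by rewrite /phi => ->.
have phiB y : y \in B -> phi y = Some ord_max.
  by move=> yB; rewrite /phi yB (disjointFl dAB yB).
have phic i : phi (c i) = Some i.
  rewrite /c; case: eqP => [->|ne]; first exact: phiA.
  rewrite phiB //; congr Some; apply: val_inj => /=.
  have : nat_of_ord i != 0 by apply: contra_notN ne => /eqP ?; apply: val_inj.
  by case: (nat_of_ord i) (ltn_ord i) => [|[|m]].
have phiP y i : phi y = Some i ->
    y = c i \/ [/\ y \in W, 0 < h y & phi (p y) = Some i].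
  rewrite {1}/phi /c; have [yA [<-]|yA] := boolP (y \in A).
    have [->|ya] := eqVneq y a; first by left.
    by right; have [hy pA] := treeA y yA ya; rewrite (phiA _ pA) !inE ya yA.
  case: (boolP (y \in B)) => // yB [<-] /=.
  have [->|yb] := eqVneq y b; first by left.
  by right; have [hy pB] := treeB y yB yb; rewrite (phiB _ pB) !inE yb yB orbT.
have ephi i : (phi @: ends (e i) = Some @: [set: 'I_2])%SET.
  have [s [t [-> sA tB]]] := eAB i.
  rewrite imsetU !imset_set1 (phiA _ sA) (phiB _ tB); apply/setP => o.
  apply/idP/imsetP => [|[j _ ->]].
    by rewrite !inE => /orP[]/eqP->; [exists ord0 | exists ord_max].
  by rewrite !inE !(inj_eq (@Some_inj _)) -!val_eqE; case: j => -[|[|m]].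
have [q qP] : {q : vertex G -> edge G & forall x, 0 < h x -> ends (q x) = [set x; p x]%SET}.
  apply: (@choice _ _ (fun x a => 0 < h x -> ends a = [set x; p x]%SET)) => x.
  have [hx|] := boolP (0 < h x); last by exists (e (Ordinal r0)).
  by have /adjacentP[f fP] := p_adj hx; exists f.
pose F := (e @: 'I_r :|: q @: W)%SET.
have leF : #|F| <= r + #|W|.
  apply: leq_trans (leq_card_setU _ _) _; apply: leq_add; last exact: leq_imset_card.
  by apply: leq_trans (leq_imset_card _ _) _; rewrite card_ord.
apply: leq_trans leF; rewrite -card_edge_span; apply: girth_ge.
split; first exact: subgraph_span.
have eF i : e i \in F by rewrite inE imset_f.
pose g (i : edge (theta r)) : edge (span F) := exist _ (e i) (eF i).
(* [span F] keeps all the vertices of [G], so [phi] is also a map on it. *)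
pose phi' : vertex (span F) -> option (vertex (theta r)) := phi.
apply: (@branch_minor _ (theta r) _ phi' g); last first.
  exact: minor_refl.
split.
- by move=> i; exists (c i).
- apply: (rooted_fibres (c := (c : vertex (theta r) -> vertex (span F)))) => i y.
  have [n] := ubnP (h y); elim: n => // n IHn in y *; rewrite ltnS => len phiy.
  have [->|[yW hy phipy]] := phiP y i phiy; first exact: connect0.
  apply: (@connect_trans _ _ (p y)).
    apply: connect1; rewrite /in_fibre phiy [phi' (p y)]phipy eqxx andbT.
    have qF : q y \in F by rewrite inE orbC imset_f.
    by apply/adjacentP; exists (exist _ (q y) qF); rewrite /= qP.
  by apply: IHn phipy; rewrite h_p // prednK.
- by move=> i j /(congr1 val) /= /ei.
- exact: ephi.
Qed.

Variable R : nat.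
Hypothesis h_le : forall x, h x <= R.

Definition forest_root x := iter (h x) p x.

Lemma h_iter x i : i <= h x -> h (iter i p x) = h x - i.
Proof.
elim: i => [|i IHi] lei /=; first by rewrite subn0.
by rewrite h_p IHi ?(ltnW lei) ?subn_gt0 // subnS.
Qed.

Lemma root_iter x i : i <= h x -> forest_root (iter i p x) = forest_root x.
Proof. by move=> lei; rewrite /forest_root h_iter // -iterD subnK. Qed.

Lemma h_root x : h (forest_root x) = 0.
Proof. by rewrite h_iter // subnn. Qed.

Lemma root_h0 x : h x = 0 -> forest_root x = x.
Proof. by rewrite /forest_root => ->. Qed.

Lemma rootK x : forest_root (forest_root x) = forest_root x.
Proof. by rewrite root_h0 ?h_root. Qed.

(** The union of the tree paths from the vertices [s j] to their roots; the
    index of a path is bounded by the depth [R] to keep the search finite. *)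
Definition paths (J : finType) (s : J -> vertex G) : {set vertex G} :=
  [set y | [exists j, exists i : 'I_R.+1, (i <= h (s j)) && (y == iter i p (s j))]]%SET.

Lemma pathsP (J : finType) (s : J -> vertex G) y :
  reflect (exists j i, i <= h (s j) /\ y = iter i p (s j)) (y \in paths s).
Proof.
rewrite inE; apply: (iffP existsP) => [[j /existsP[i /andP[lei /eqP->]]]|[j [i [lei ->]]]].
  by exists j, i.
have iR : i < R.+1 by rewrite ltnS (leq_trans lei).
by exists j; apply/existsP; exists (Ordinal iR); rewrite /= lei eqxx.
Qed.

Section Paths.
Variables (J : finType) (s : J -> vertex G).

Lemma start_paths j : s j \in paths s.
Proof. by apply/pathsP; exists j, 0. Qed.

Lemma root_paths j : forest_root (s j) \in paths s.
Proof. by apply/pathsP; exists j, (h (s j)). Qed.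

Lemma parent_paths y : y \in paths s -> 0 < h y -> p y \in paths s.
Proof.
case/pathsP=> j [i [lei ->]]; rewrite h_iter // subn_gt0 => lti.
by apply/pathsP; exists j, i.+1.
Qed.

Lemma paths_info y : y \in paths s ->
  exists j, forest_root y = forest_root (s j) /\ h y <= h (s j).
Proof.
case/pathsP=> j [i [lei ->]]; exists j; rewrite root_iter // h_iter //.
by rewrite leq_subr.
Qed.

Lemma card_paths : #|[set y in paths s | 0 < h y]%SET| <= R * #|J|.
Proof.
rewrite -[R in R * _]card_ord -card_prod.
pose f (k : 'I_R * J) := iter k.1 p (s k.2).
apply: leq_trans (leq_imset_card f _); apply: subset_leq_card.
apply/fintype.subsetP => y; rewrite inE => /andP[/pathsP[j [i [lei ->]]]].
rewrite h_iter // subn_gt0 => lti.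
by apply/imsetP; exists (Ordinal (leq_trans lti (h_le (s j))), j).
Qed.
End Paths.

Lemma paths_tree (J : finType) (s : J -> vertex G) c :
  (forall j, forest_root (s j) = c) ->
  {in paths s, forall y, y != c -> 0 < h y /\ p y \in paths s}.
Proof.
move=> sc y yP yc; suff hy : 0 < h y by split=> //; apply: parent_paths.
rewrite lt0n; apply: contra yc => /eqP /root_h0 <-.
by have [j [-> _]] := paths_info yP; rewrite sc.
Qed.

Lemma card_paths_tree (J : finType) (s : J -> vertex G) c :
  (forall j, forest_root (s j) = c) -> #|paths s :\ c| <= R * #|J|.
Proof.
move=> sc; apply: leq_trans (card_paths s); apply: subset_leq_card.
apply/fintype.subsetP => y; rewrite in_setD1 => /andP[yc yP].
by rewrite inE yP; case: (paths_tree sc yP yc) => ->.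
Qed.

Hypothesis r_gt0 : 0 < r.

(** The paths from these neighbours to the root avoid [x], because depths
    decrease along them and start at most at the depth of [x]. Hence [r] such
    neighbours would give theta_r between [x] alone and a tree. *)
Lemma few_neighbours_below x :
  r + R * r < z ->
  #|[set y in neighbours x | (forest_root y == forest_root x) && (h y <= h x)]%SET| < r.
Proof.
move=> small; rewrite ltnNge; apply/negP => /injection_into_set[t [ti tA]].
have tP i : [/\ adjacent x (t i), forest_root (t i) = forest_root x & h (t i) <= h x].
  by have := tA i; rewrite !inE => /andP[? /andP[/eqP ? ?]].
have troot i : forest_root (t i) = forest_root x by case: (tP i).
have [e eP] : {e : 'I_r -> edge G & forall i, ends (e i) = [set x; t i]%SET}.
  apply: (@choice _ _ (fun i a => ends a = [set x; t i]%SET)) => i.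
  by have [/adjacentP] := tP i.
have xt : x \notin paths t.
  apply/pathsP => -[i [k [lek E]]]; have [xti _ hti] := tP i.
  have := congr1 h E; rewrite h_iter // => hx.
  case: k lek E hx => [|k] lek E hx; first by have := adjacent_neq xti; rewrite {1}E eqxx.
  by move: hti lek hx; clear; lia.
pose i0 : 'I_r := Ordinal r_gt0.
suff large : z <= r + #|[set x]%SET :\ x :|: paths t :\ forest_root x|.
  move: small; rewrite ltnNge => /negP[]; apply: leq_trans large _.
  rewrite leq_add2l finset.setDv finset.set0U -[X in _ * X]card_ord.
  exact: card_paths_tree.
apply: (@theta_from_trees e) => //.
- move=> i j E; apply: ti; have := eP i; rewrite E eP => /set2_inj[[]//|[E1 E2]].
  by rewrite E2 -E1.
- by rewrite finset.disjoints1.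
- by rewrite inE.
- by rewrite -(troot i0) root_paths.
- by move=> y; rewrite inE => /eqP ->; rewrite eqxx.
- exact: paths_tree.
- by move=> i; exists x, (t i); rewrite inE eqxx start_paths; split.
Qed.

(** The [r] edges would join two disjoint trees, each the union of at most [r]
    paths of length at most [R]. *)
Lemma few_cross_edges c c' :
  r + 2 * R * r < z -> c != c' ->
  #|[set q : vertex G * vertex G |
      [&& adjacent q.1 q.2, forest_root q.1 == c & forest_root q.2 == c']]%SET| < r.
Proof.
move=> small cc'; rewrite ltnNge; apply/negP => /injection_into_set[t [ti tA]].
have tP i :
    [/\ adjacent (t i).1 (t i).2, forest_root (t i).1 = c & forest_root (t i).2 = c'].
  by have := tA i; rewrite !inE => /and3P[? /eqP ? /eqP ?].
have [e eP] : {e : 'I_r -> edge G & forall i, ends (e i) = [set (t i).1; (t i).2]%SET}.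
  apply: (@choice _ _ (fun i a => ends a = [set (t i).1; (t i).2]%SET)) => i.
  by have [/adjacentP] := tP i.
pose s1 i := (t i).1; pose s2 i := (t i).2.
have r1 i : forest_root (s1 i) = c by case: (tP i).
have r2 i : forest_root (s2 i) = c' by case: (tP i).
pose i0 : 'I_r := Ordinal r_gt0.
suff large : z <= r + #|paths s1 :\ c :|: paths s2 :\ c'|.
  move: small; rewrite ltnNge => /negP[]; apply: leq_trans large _.
  rewrite leq_add2l; apply: leq_trans (leq_card_setU _ _) _.
  rewrite -mulnA mul2n -addnn; apply: leq_add.
    by rewrite -[X in _ * X]card_ord; apply: card_paths_tree.
  by rewrite -[X in _ * X]card_ord; apply: card_paths_tree.
apply: (@theta_from_trees e) => //.
- move=> i j E; apply: ti; have := eP i; rewrite E eP => /set2_inj[[E1 E2]|[E1 E2]].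
    by rewrite [t i]surjective_pairing -E1 -E2 -surjective_pairing.
  by case/negP: cc'; rewrite -(r1 j) /s1 E1 -/(s2 i) r2.
- rewrite disjoint_subset; apply/fintype.subsetP => y yP; rewrite inE; apply/negP => yP2.
  have [j [E _]] := paths_info yP; have [j2 [E2 _]] := paths_info yP2.
  by case/negP: cc'; rewrite -(r1 j) -(r2 j2) -E E2.
- by rewrite -(r1 i0) root_paths.
- by rewrite -(r2 i0) root_paths.
- exact: paths_tree.
- exact: paths_tree.
- by move=> i; exists (s1 i), (s2 i); rewrite !start_paths; split=> //; apply: eP.
Qed.
End Forest.
End ThetaModel.

(** * Counting edges between layers and between cells *)

Lemma card_pairs (T : finType) (A : {set T}) (e : rel T) :
  #|[set q : T * T | (q.1 \in A) && e q.1 q.2]%SET| =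
  \sum_(x in A) #|[set y | e x y]%SET|.
Proof.
rewrite -sum1_card (eq_bigl (fun q => (q.1 \in A) && e q.1 q.2)); last first.
  by move=> q; rewrite inE.
rewrite -(pair_big_dep (mem A) e (fun _ _ => 1)) /=.
by apply: eq_bigr => x _; rewrite -sum1_card; apply: eq_bigl => y; rewrite inE.
Qed.

Lemma card_pairs_swap (T : finType) (P : rel T) :
  #|[set q : T * T | P q.1 q.2]%SET| = #|[set q : T * T | P q.2 q.1]%SET|.
Proof.
have swap_inj : injective (fun q : T * T => (q.2, q.1)) by move=> [x y] [u v] [-> ->].
rewrite -(card_imset _ swap_inj); apply: eq_card => -[x y].
rewrite inE; apply/imsetP/idP => [[[u v] + [-> ->]]|]; first by rewrite inE.
by move=> xy; exists (y, x) => //; rewrite inE.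
Qed.

Section Counting.
Variables (G : mgraph) (p : vertex G -> vertex G) (h : vertex G -> nat).
Variables (d s rho : nat).
Local Notation root := (forest_root p h).

Definition below x : {set vertex G} :=
  [set y in neighbours x | (root y == root x) && (h y <= h x)]%SET.
Definition cross c c' : {set vertex G * vertex G} :=
  [set q | [&& adjacent q.1 q.2, root q.1 == c & root q.2 == c']]%SET.
Definition cell c : {set vertex G} := [set x | root x == c]%SET.
Definition cell_neighbours c : {set vertex G} :=
  [set c' | (c' != c) && (cross c c' != finset.set0)]%SET.
Definition layer c i : {set vertex G} := [set x | (root x == c) && (h x == i)]%SET.

Hypothesis deg_ge : forall x : vertex G, d <= degree x.
Hypothesis le_below : forall x, #|below x| <= s.

(** An edge inside the cell is counted below one of its ends, so at most [s]
    times the size of the cell edges are inside, and each counts twice in the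
    sum of the degrees. *)
Lemma cell_boundary c :
  (forall c', c' != c -> #|cross c c'| <= s) ->
  #|cell c| * (d - 2 * s) <= s * #|cell_neighbours c|.
Proof.
move=> le_cross.
pose out := [set q : vertex G * vertex G | (q.1 \in cell c) &&
  (adjacent q.1 q.2 && (root q.2 != c))]%SET.
pose inn := [set q : vertex G * vertex G | (q.1 \in cell c) && (q.2 \in below q.1)]%SET.
pose inn' := [set q : vertex G * vertex G | (q.2 \in cell c) && (q.1 \in below q.2)]%SET.
pose all := [set q : vertex G * vertex G | (q.1 \in cell c) && adjacent q.1 q.2]%SET.
have le_inn : #|inn| <= #|cell c| * s.
  rewrite /inn (card_pairs (cell c) (fun x y => y \in below x)) -sum_nat_const.
  by apply: leq_sum => x _; rewrite cardsE; apply: le_below.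
have inn'E : #|inn'| = #|inn|.
  exact: (card_pairs_swap (fun x y => (y \in cell c) && (x \in below y))).
have le_all : #|cell c| * d <= #|all|.
  rewrite /all card_pairs -sum_nat_const; apply: leq_sum => x _; exact: deg_ge.
have sub : all \subset out :|: (inn :|: inn').
  apply/fintype.subsetP => -[x y]; rewrite !inE /= => /andP[/eqP xc xy].
  rewrite xc xy eqxx /=; have [yc|//] := eqVneq (root y) c; rewrite /= adjacent_sym xy /=.
  exact: leq_total.
have le1 : #|cell c| * d <= #|out| + 2 * (#|cell c| * s).
  apply: leq_trans le_all _; apply: leq_trans (subset_leq_card sub) _.
  apply: leq_trans (leq_card_setU _ _) _; rewrite leq_add2l.
  apply: leq_trans (leq_card_setU _ _) _; rewrite inn'E addnn -mul2n leq_mul2l.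
  exact: le_inn.
have sub2 : out \subset (\bigcup_(c' in cell_neighbours c) cross c c')%SET.
  apply/fintype.subsetP => -[x y]; rewrite !inE /= => /and3P[xc xy yc].
  have xyc : (x, y) \in cross c (root y) by rewrite inE /= xy xc eqxx.
  apply/bigcupP; exists (root y) => //; rewrite inE yc; apply/set0Pn.
  by exists (x, y).
have le2 : #|out| <= s * #|cell_neighbours c|.
  apply: leq_trans (subset_leq_card sub2) _.
  apply: leq_trans (card_bigcup_le _ _) _; rewrite mulnC -sum_nat_const.
  apply: leq_sum => c'.
  by rewrite inE => /andP[/le_cross].
rewrite mulnBr leq_subLR; apply: leq_trans le1 _.
by rewrite addnC mulnCA leq_add2l.
Qed.

Hypothesis h_lip : forall x y : vertex G, adjacent x y -> h y <= (h x).+1.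
Hypothesis near_cell : forall x y : vertex G, adjacent x y -> h x < rho -> root y = root x.

(** Count the edges between layers [i] and [i + 1]: a vertex of layer [i] sends
    there all its neighbours but the at most [s] below it, and a vertex of layer
    [i + 1] finds its neighbours in layer [i] below itself. *)
Lemma layer_growth c i :
  i < rho -> #|layer c i| * (d - s) <= s * #|layer c i.+1|.
Proof.
move=> lti.
pose P := [set q : vertex G * vertex G | (q.1 \in layer c i) &&
  (adjacent q.1 q.2 && (q.2 \in layer c i.+1))]%SET.
have low : #|layer c i| * (d - s) <= #|P|.
  rewrite /P (card_pairs (layer c i) (fun x y => adjacent x y && (y \in layer c i.+1))).
  rewrite -sum_nat_const; apply: leq_sum => x; rewrite inE => /andP[/eqP xc /eqP xi].
  rewrite leq_subLR; apply: leq_trans (deg_ge x) _.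
  apply: leq_trans (leq_add (le_below x) (leqnn _)).
  apply: leq_trans (leq_card_setU _ _); apply: subset_leq_card.
  apply/fintype.subsetP => y; rewrite !inE => xy; rewrite xy /= -xc -xi.
  have := near_cell xy; rewrite xi => -> //; rewrite eqxx /=.
  by have := h_lip xy; rewrite xi leq_eqVlt ltnS orbC.
apply: leq_trans low _; rewrite /P.
rewrite (card_pairs_swap (fun x y =>
  (x \in layer c i) && (adjacent x y && (y \in layer c i.+1)))).
pose P' := [set q : vertex G * vertex G |
  (q.1 \in layer c i.+1) && (q.2 \in below q.1)]%SET.
have sub : [set q | (q.2 \in layer c i) && (adjacent q.2 q.1 && (q.1 \in layer c i.+1))]%SET
    \subset P'.
  apply/fintype.subsetP => -[x y]; rewrite !inE /=.
  case/and3P=> /andP[/eqP yc /eqP yi] yx /andP[/eqP xc /eqP xi].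
  by rewrite xc xi yc yi adjacent_sym yx !eqxx leqnSn.
apply: leq_trans (subset_leq_card sub) _.
rewrite /P' (card_pairs (layer c i.+1) (fun x y => y \in below x)) mulnC -sum_nat_const.
by apply: leq_sum => x _; rewrite cardsE; apply: le_below.
Qed.

Lemma cell_growth c i : root c = c -> h c = 0 -> i <= rho ->
  (d - s) ^ i <= s ^ i * #|layer c i|.
Proof.
move=> cc hc; elim: i => [|i IHi] lti.
  by rewrite !expn0 mul1n; apply/card_gt0P; exists c; rewrite inE cc hc !eqxx.
rewrite expnSr; apply: leq_trans (leq_mul (IHi (ltnW lti)) (leqnn _)) _.
rewrite -mulnA expnSr -mulnA leq_mul2l layer_growth ?orbT //.
Qed.

Lemma cell_neighbours_many c : root c = c -> h c = 0 ->
  (forall c', c' != c -> #|cross c c'| <= s) ->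
  (d - 2 * s) * (d - s) ^ rho <= s ^ rho.+1 * #|cell_neighbours c|.
Proof.
move=> cc hc le_cross; have le1 := cell_boundary le_cross.
have le2 := cell_growth cc hc (leqnn rho).
have le3 : #|layer c rho| <= #|cell c|.
  by apply: subset_leq_card; apply/fintype.subsetP => x; rewrite !inE => /andP[].
apply: leq_trans (leq_mul (leqnn _) le2) _.
rewrite mulnCA expnSr -mulnA leq_mul2l; apply/orP; right.
by apply: leq_trans le1; rewrite mulnC leq_mul2r le3 orbT.
Qed.
End Counting.

(** * Partition into cells and the quotient graph *)

Section Reach.
Variable G : mgraph.

Fixpoint reach n (x y : vertex G) : bool :=
  if n is m.+1 then (x == y) || [exists z, adjacent x z && reach m z y] else x == y.

Lemma reach_refl n x : reach n x x.
Proof. by case: n => [|n] /=; rewrite eqxx. Qed.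

Lemma reach_step n x z y : adjacent x z -> reach n z y -> reach n.+1 x y.
Proof. by move=> xz zy /=; apply/orP; right; apply/existsP; exists z; rewrite xz. Qed.

Lemma reachS_inv n x y : reach n.+1 x y ->
  x = y \/ exists2 z, adjacent x z & reach n z y.
Proof.
by case/orP=> [/eqP|/existsP[z /andP[]]]; [left | right; exists z].
Qed.

Lemma reach_leq m n x y : m <= n -> reach m x y -> reach n x y.
Proof.
elim: m n x => [|m IHm] n x; first by move=> _ /eqP->; apply: reach_refl.
case: n => // n; rewrite ltnS => lemn /reachS_inv[->|[z xz zy]].
  exact: reach_refl.
exact: reach_step xz (IHm _ _ lemn zy).
Qed.

Lemma reach_trans m n x y z : reach m x y -> reach n y z -> reach (m + n) x z.
Proof.
elim: m x => [|m IHm] x; first by move/eqP->.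
case/reachS_inv=> [->|[w xw wy]] yz; first exact: reach_leq (leq_addl _ _) yz.
exact: reach_step xw (IHm _ wy yz).
Qed.

Lemma reach_sym n x y : reach n x y -> reach n y x.
Proof.
elim: n x => [|n IHn] x; first by rewrite /= eq_sym.
case/reachS_inv=> [->|[z xz zy]]; first exact: reach_refl.
rewrite -addn1; apply: reach_trans (IHn _ zy) _.
by rewrite adjacent_sym in xz; apply: reach_step xz (reach_refl 0 x).
Qed.

(** Take a maximal set without two members within distance [n]: a vertex farther
    than [n] from all members could be added. *)
Lemma scattered_centres n : exists C : {set vertex G},
  {in C &, forall x y, reach n x y -> x = y} /\
  forall x, exists2 c, c \in C & reach n x c.
Proof.
pose scattered (C : {set vertex G}) :=
  [forall x in C, forall y in C, reach n x y ==> (x == y)].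
have [|C maxC] := @ex_maxset _ scattered.
  by exists finset.set0; apply/forall_inP => x; rewrite inE.
have scC : {in C &, forall x y, reach n x y -> x = y}.
  move=> x y xC yC xy; apply/eqP.
  by have /forall_inP/(_ x xC)/forall_inP/(_ y yC)/implyP/(_ xy) := maxsetp maxC.
exists C; split=> // x; apply: contrapT => noc.
have far c : c \in C -> ~~ reach n x c by move=> cC; apply/negP => ?; apply: noc; exists c.
have sc : scattered (x |: C).
  apply/forall_inP => u uC; apply/forall_inP => v vC; apply/implyP => uv.
  rewrite !inE in uC vC; case/orP: uC => [/eqP E|uC]; case/orP: vC => [/eqP E'|vC].
  - by rewrite E E'.
  - by rewrite E in uv; have := far v vC; rewrite uv.
  - by move/reach_sym: uv; rewrite E' => uv; have := far u uC; rewrite uv.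
  - by apply/eqP/scC.
have xC : x \in C by rewrite -(maxsetsup maxC sc (finset.subsetUr _ _)) finset.setU11.
by have := far x xC; rewrite reach_refl.
Qed.

(** Depth is the distance to the set of centres. For the last property: the
    roots of [x] and [y] are joined through [x y] by a walk of length at most
    [h x + 1 + h y], which is at most [2 * rho] when [h x < rho], and distinct
    centres are farther apart. *)
Lemma shallow_forest rho :
  exists (p : vertex G -> vertex G) (h : vertex G -> nat),
  [/\ forall x, 0 < h x -> adjacent x (p x),
      forall x, 0 < h x -> h (p x) = (h x).-1,
      forall x, h x <= 2 * rho,
      forall x y, adjacent x y -> h y <= (h x).+1
    & forall x y, adjacent x y -> h x < rho -> forest_root p h y = forest_root p h x].
Proof.
have [C [scC coverC]] := scattered_centres (2 * rho).
have [h hP] : {h : vertex G -> nat & forall x,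
    (exists2 c, c \in C & reach (h x) x c) /\
    forall n c, c \in C -> reach n x c -> h x <= n}.
  apply: (@choice _ _ (fun x n => (exists2 c, c \in C & reach n x c) /\
    forall m c, c \in C -> reach m x c -> n <= m)) => x.
  have exP : exists n, [exists c in C, reach n x c].
    by have [c cC xc] := coverC x; exists (2 * rho); apply/exists_inP; exists c.
  case: (ex_minnP exP) => n /exists_inP nP min; exists n; split=> // m c cC xc.
  by apply: min; apply/exists_inP; exists c.
have hC x : exists2 c, c \in C & reach (h x) x c by case: (hP x).
have h_min x n c : c \in C -> reach n x c -> h x <= n by case: (hP x) => _ min; apply: min.
have lip x y : adjacent x y -> h y <= (h x).+1.
  rewrite adjacent_sym => yx; have [c cC xc] := hC x.
  exact: h_min cC (reach_step yx xc).
have [p pP] : {p : vertex G -> vertex G & forall x, 0 < h x ->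
    adjacent x (p x) /\ h (p x) = (h x).-1}.
  apply: (@choice _ _ (fun x z => 0 < h x -> adjacent x z /\ h z = (h x).-1)) => x.
  case E: (h x) => [|n]; first by exists x.
  have [c cC] := hC x; rewrite E => /reachS_inv[xc|[z xz zc]].
    by have := h_min x 0 c cC; rewrite E xc /= eqxx => /(_ isT).
  exists z => _; split=> //=; apply/eqP; rewrite eqn_leq (h_min _ _ _ cC zc) /=.
  by rewrite -ltnS -E; apply: lip; rewrite adjacent_sym.
have p_adj x : 0 < h x -> adjacent x (p x) by case/pP.
have h_p x : 0 < h x -> h (p x) = (h x).-1 by case/pP.
exists p, h; split=> //.
- by move=> x; have [c cC xc] := coverC x; apply: h_min xc.
have reach_iter x i : i <= h x -> reach i x (iter i p x).
  elim: i => [|i IHi] lti; first exact: reach_refl.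
  rewrite -[X in reach X]addn1; apply: reach_trans (IHi (ltnW lti)) _.
  apply: (@reach_step 0 _ (iter i.+1 p x)); last exact: reach_refl.
  apply: p_adj.
  by rewrite h_iter ?(ltnW lti) // subn_gt0.
have reach_root x : reach (h x) x (forest_root p h x) by apply: reach_iter.
have root_C x : forest_root p h x \in C.
  by have [c cC] := hC (forest_root p h x); rewrite h_root //= => /eqP->.
move=> x y xy hx; apply: scC => //.
apply: (@reach_leq (h y + (1 + h x))).
  by have := lip _ _ xy; lia.
apply: reach_trans (reach_sym (reach_root y)) (reach_trans _ (reach_root x)).
by rewrite adjacent_sym in xy; apply: reach_step xy (reach_refl 0 x).
Qed.
End Reach.

Section Quotient.
Variables (T : finType) (e : rel T).

Lemma card_ends_simple
    (A : {A : {set T} | [exists x, exists y, [&& x != y, e x y & A == [set x; y]%SET]]}) :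
  #|val A| = 2.
Proof.
by case: A => A /= /existsP[x /existsP[y /and3P[xy _ /eqP->]]]; rewrite cards2 xy.
Qed.

Definition simple_mgraph : mgraph := MGraph card_ends_simple.

Lemma adjacent_simple x y : x != y -> e x y -> adjacent (G := simple_mgraph) x y.
Proof.
move=> xy exy; apply/adjacentP.
have P : [exists u, exists v, [&& u != v, e u v & [set x; y]%SET == [set u; v]%SET]].
  by apply/existsP; exists x; apply/existsP; exists y; rewrite xy exy eqxx.
by exists (exist _ [set x; y]%SET P).
Qed.
End Quotient.

(** Cells are connected through their trees, so contracting them is a branch
    model of the quotient graph on the roots; the theta models that would break
    the counting hypotheses have fewer than [z] edges because [rho] is small. *)
Lemma quotient_minor (G : mgraph) (d r z rho : nat) :
  0 < r -> (forall M, is_model (theta r) G M -> z <= #|edge M|) ->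
  r + 2 * (2 * rho) * r < z ->
  (forall x : vertex G, d <= degree x) -> 0 < #|vertex G| ->
  exists Q : mgraph,
    [/\ forall K, minor K Q -> minor K G,
        0 < #|vertex Q|
      & forall c : vertex Q,
          (d - 2 * r.-1) * (d - r.-1) ^ rho <= r.-1 ^ rho.+1 * degree c].
Proof.
move=> r0 girth_ge small deg_ge V0.
have [p [h [p_adj h_p h_le h_lip near]]] := shallow_forest G rho.
have ltr a : (a < r) = (a <= r.-1) by rewrite -{1}(prednK r0) ltnS.
have le_below x : #|below p h x| <= r.-1.
  rewrite -ltr; apply: (few_neighbours_below girth_ge p_adj h_p h_le r0).
  apply: leq_ltn_trans small; rewrite leq_add2l leq_mul2r; apply/orP; right.
  by rewrite leq_pmull.
have le_cross c c' : c' != c -> #|cross p h c c'| <= r.-1.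
  rewrite -ltr eq_sym => cc'.
  exact: (few_cross_edges girth_ge p_adj h_p h_le r0 small cc').
pose VQ : finType := {c : vertex G | forest_root p h c == c}.
have rootP x : forest_root p h (forest_root p h x) == forest_root p h x.
  by apply/eqP; apply: rootK.
pose cls x : VQ := exist _ (forest_root p h x) (rootP x).
pose eQ (c c' : VQ) := cross p h (val c) (val c') != finset.set0.
pose Q := simple_mgraph eQ.
pose phi x : option (vertex Q) := Some (cls x).
have [||||g gP] := @branch_model_simple Q G phi.
- exact: val_inj.
- move=> c; exists (val c); rewrite /phi; congr Some; apply: val_inj => /=.
  exact/eqP/(valP c).
- apply: (rooted_fibres (c := (val : vertex Q -> vertex G))) => c y.
  have [n] := ubnP (h y); elim: n => // n IHn in y *; rewrite ltnS => len [yc].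
  have [hy|hy] := posnP (h y).
    by rewrite -yc /= root_h0.
  apply: (@connect_trans _ _ (p y)).
    apply: connect1; rewrite /in_fibre p_adj //=; apply/eqP; congr Some.
    by apply: val_inj; rewrite /= -(@root_iter _ _ _ h_p y 1).
  apply: IHn; first by rewrite h_p // prednK.
  by rewrite -yc; congr Some; apply: val_inj; rewrite /= -(@root_iter _ _ _ h_p y 1).
- case=> A /= /existsP[c /existsP[c' /and3P[cc' /set0Pn[[x y]] + /eqP->]]].
  rewrite !inE /= => /and3P[xy /eqP xc /eqP yc]; exists x, y; split=> //.
  rewrite imsetU !imset_set1 /phi; congr [set Some _; Some _]%SET; exact: val_inj.
exists Q; split; first by move=> K; apply: branch_minor gP.
  by have [x _] := card_gt0P V0; apply/card_gt0P; exists (cls x).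
move=> c; have cc : forest_root p h (val c) = val c by apply/eqP/(valP c).
have hc : h (val c) = 0 by rewrite -cc h_root.
apply: leq_trans (cell_neighbours_many deg_ge le_below h_lip near cc hc _) _.
  by move=> c'; apply: le_cross.
rewrite leq_mul2l; apply/orP; right.
rewrite /degree -(card_imset (neighbours c) val_inj); apply: subset_leq_card.
apply/fintype.subsetP => c'; rewrite inE => /andP[cc' ne].
have /set0Pn[[x y]] := ne; rewrite inE => /and3P[_ _ /= /eqP yc'].
have c'P : forest_root p h c' == c' by rewrite -yc'.
apply/imsetP; exists (exist _ c' c'P : VQ) => //; rewrite inE.
by apply: adjacent_simple => //; rewrite -val_eqE eq_sym.
Qed.

(** * Numerical estimates and the theorem *)

Lemma clique1_minor (G : mgraph) : 0 < #|vertex G| -> minor (clique 1) G.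
Proof.
case/card_gt0P=> x0 _.
pose phi x : option (vertex (clique 1)) := if x == x0 then Some ord0 else None.
have [||||g gP] := @branch_model_simple (clique 1) G phi.
- exact: clique_ends_inj.
- by move=> i; exists x0; rewrite /phi eqxx [i]ord1.
- move=> x y; rewrite /phi; have [->|//] := eqVneq x x0.
  by have [-> _ _|//] := eqVneq y x0; apply: connect0.
- move=> e; have := max_card (mem (ends e)); rewrite card_ends card_ord; by [].
apply: (branch_minor gP); exact: minor_refl.
Qed.

Local Open Scope ring_scope.

(** Divide by [(r - 1) ^ (rho + 1)]: with x = d / r the two factors become
    (x - 2) (x - 1) ^ rho at least, and for x >= 3 the square root of x is at most
    x - 1 and at most 3 (x - 2). *)
Lemma degree_lower_bound (R : realType) (d r rho q : nat) :
  (2 <= r)%N -> (3 * r <= d)%N ->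
  ((d - 2 * r.-1) * (d - r.-1) ^ rho <= r.-1 ^ rho.+1 * q)%N ->
  Num.sqrt (d%:R / r%:R : R) ^+ rho.+1 <= 3 * q%:R.
Proof.
move=> r2 dr; set s := r.-1 => nat_le; set x : R := d%:R / r%:R.
have s1 : (1 <= s)%N by rewrite /s; lia.
have s0 : 0 < s%:R :> R by rewrite ltr0n.
have r0 : 0 < r%:R :> R by rewrite ltr0n; lia.
have sr : s%:R <= r%:R :> R by rewrite ler_nat /s; lia.
have x3 : 3 <= x by rewrite /x ler_pdivlMr // -natrM ler_nat.
have xs : x * s%:R <= d%:R.
  by rewrite /x mulrAC ler_pdivrMr // ler_wpM2l.
have e1 : (x - 2) * s%:R <= (d - 2 * s)%:R.
  rewrite natrB; last by rewrite /s; lia.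
  by rewrite natrM; lra.
have e2 : (x - 1) * s%:R <= (d - s)%:R.
  rewrite natrB; last by rewrite /s; lia.
  by lra.
set w := Num.sqrt x; have w0 : 0 <= w by apply: sqrtr_ge0.
have ww : w ^+ 2 = x by rewrite sqr_sqrtr //; lra.
have w1 : w <= x - 1 by nra.
have w2 : w <= 3 * (x - 2) by nra.
have nat_ineq : (d - 2 * s)%:R * (d - s)%:R ^+ rho <= s%:R ^+ rho.+1 * q%:R :> R.
  by rewrite -!natrX -!natrM ler_nat.
have s_ineq : w ^+ rho.+1 * s%:R ^+ rho.+1 <= 3 * q%:R * s%:R ^+ rho.+1.
  have f1 : w * s%:R <= 3 * (d - 2 * s)%:R by nra.
  have f2 : w * s%:R <= (d - s)%:R by nra.
  have ws0 : 0 <= w * s%:R by rewrite mulr_ge0 // ltW.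
  rewrite -exprMn exprS.
  apply: (@le_trans _ _ (3 * (d - 2 * s)%:R * (d - s)%:R ^+ rho)); last first.
    by move: (s%:R ^+ _) (_ ^+ rho) nat_ineq => a b; lra.
  by apply: ler_pM => //; [exact: exprn_ge0 | apply: lerXn2r; rewrite ?nnegrE].
by rewrite ler_pM2r ?exprn_gt0 // in s_ineq.
Qed.

Lemma exponent_bound (R : realType) (x u : R) n :
  1 <= x -> 16 * u <= n%:R -> (x `^ u) ^+ 8 <= Num.sqrt x ^+ n.
Proof.
move=> x1 un; have x0 : 0 <= x by apply: le_trans x1.
rewrite -powR_mulrn ?powR_ge0 // -powRrM -powR12_sqrt // -powR_mulrn ?powR_ge0 //.
by rewrite -powRrM ler_powR //; lra.
Qed.

Lemma sqrt_ge2 (R : realType) (v : R) (d : nat) :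
  (4 <= d)%N -> 2 <= v -> 2 <= Num.sqrt (v * log2 d%:R).
Proof.
move=> d4 v2; have d4' : 4 <= d%:R :> R by rewrite ler_nat.
have ln2 : 0 < ln 2 :> R by rewrite ln_gt0 // ltr1n.
have l2 : 2 <= log2 (d%:R : R).
  rewrite /log2 ler_pdivlMr // mulr_natl -lnXn // ler_ln ?posrE //; first by lra.
  by lra.
rewrite -[leLHS]ger0_norm // -sqrtr_sqr ler_sqrt; first by nra.
by nra.
Qed.

(** The largest depth for which the theta models of [few_cross_edges], with trees
    of depth [2 * rho], are too small to exist. *)
Lemma depth_choice (z r : nat) : (0 < r)%N -> (2 * r <= z)%N ->
  exists rho, (r + 2 * (2 * rho) * r < z)%N /\ (z <= 5 * (rho.+1 * r))%N.
Proof.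
move=> r0 zr; exists ((z - r - 1) %/ (4 * r))%N.
set m := (_ %/ _)%N.
have := leq_divM (z - r - 1) (4 * r); have := @ltn_ceil (z - r - 1) (4 * r).
rewrite muln_gt0 r0 -/m => /(_ isT); rewrite !(mulnC _ (4 * r)%N).
by split; nia.
Qed.

Theorem theorem1p1 (R : realType) :
  exists c : R, 0 < c /\
    forall r d z : nat,
      (2 <= r)%N -> (3 * r <= d)%N -> (2 * r <= z)%N ->
      forall G : mgraph,
        has_min_degree G d ->
        (z%:R%:E <= girth R (theta r) G)%E ->
        exists k : nat,
          (d%:R / r%:R) `^ (c * (z%:R / r%:R))
            / Num.sqrt (z%:R / r%:R * log2 d%:R) <= k%:R
          /\ minor (clique k) G.
Proof.
(* As [z / r <= 5 * (rho + 1)], the eighth power of the target is at most the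
   power [(rho + 1) / 2] of [d / r], which bounds the degrees of the quotient. *)
exists (80^-1); split; first by rewrite invr_gt0.
move=> r d z r2 dr zr G [[x0 _] deg_ge] girth_ge.
have r0 : (0 < r)%N by apply: leq_trans r2.
have rR : 0 < r%:R :> R by rewrite ltr0n.
have V0 : (0 < #|vertex G|)%N by apply/card_gt0P; exists x0.
have model_ge M : is_model (theta r) G M -> (z <= #|edge M|)%N.
  move=> MP; rewrite -(ler_nat R) -lee_fin; apply: le_trans girth_ge _.
  by apply: ereal_inf_lbound; exists #|edge M| => //; exists M.
have [rho [rho_small rho_large]] := depth_choice r0 zr.
have [Q [QG VQ0 degQ]] := quotient_minor r0 model_ge rho_small deg_ge V0.
set x : R := d%:R / r%:R; set v : R := z%:R / r%:R.
have x3 : 3 <= x by rewrite /x ler_pdivlMr // -natrM ler_nat.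
have v2 : 2 <= v by rewrite /v ler_pdivlMr // -natrM ler_nat.
have v5 : v <= 5 * rho.+1%:R.
  by rewrite /v ler_pdivrMr // -mulrA -!natrM ler_nat.
set t := x `^ _; have t0 : 0 <= t by apply: powR_ge0.
have t8 : t ^+ 8 <= Num.sqrt x ^+ rho.+1.
  by apply: exponent_bound; lra.
have tdeg (c : vertex Q) : t ^+ 8 <= 3 * (degree c)%:R.
  by apply: le_trans t8 _; apply: degree_lower_bound (degQ c).
have S2 : 2 <= Num.sqrt (v * log2 d%:R) by apply: sqrt_ge2 => //; lia.
have bound k : t <= 2 * k%:R -> t / Num.sqrt (v * log2 d%:R) <= k%:R.
  move=> tk; rewrite ler_pdivrMr; last by lra.
  by have := ler0n R k; nra.
(* The denominator is at least 2, so for [t <= 2] a single vertex is enough. *)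
have [t2|t2] := leP t 2.
  by exists 1%N; split; [apply: bound; lra | apply: clique1_minor].
(* For [t > 2] the degree is at least [t ^ 8 / 3], more than [12 * t ^ 2]. *)
pose k := Num.truncn t; have /andP[kt tk] := truncn_itv t0.
rewrite -/k in kt tk.
have k2 : (2 <= k)%N by rewrite truncn_ge_nat // ltW.
have k2R : 2 <= k%:R :> R by rewrite ler_nat.
exists k; split.
  by apply: bound; rewrite -natr1 in tk; lra.
apply: QG; apply: (@clique_minor_of_size Q k (6 * k ^ 2)) => //.
  by apply: leq_trans k2.
rewrite mulnC -sum_nat_const; apply: leq_sum => c _.
rewrite -(ler_nat R) !natrM; have := tdeg c.
have kt2 : k%:R ^+ 2 <= t ^+ 2 :> R by rewrite ler_pXn2r ?nnegrE.
have t6 : 36 <= t ^+ 6.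
  apply: (@le_trans _ _ (2 ^+ 6)); first by rewrite -natrX ler_nat.
  by rewrite ler_pXn2r ?nnegrE // ltW.
have -> : t ^+ 8 = t ^+ 6 * t ^+ 2 by rewrite -exprD.
by nra.
Qed.
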